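(* Let $\sigma=\{\sigma_i\mid i\in I\}$ be a partition of the set $\mathbb{P}$ of all primes, and let $\mathfrak{H}_\sigma$ be the class of all finite soluble groups $G$ such that every complete Hall $\sigma$-set of $G$ forms a $\sigma$-basis of $G$. Then: (1) $\mathfrak{H}_\sigma$ is a hereditary formation, and it is saturated if and only if $|\sigma|\leq 2$. (2) A finite group $G$ belongs to $\mathfrak{H}_\sigma$ if and only if $G$ is soluble and, for every prime $p$ and every chief factor $H/K$ of $G$ of order divisible by $p$, the automorphism group $G/C_G(H/K)$ induced by $G$ on $H/K$ is either a $\sigma_i$-group for some $\sigma_i\in\sigma$ with $p\notin\sigma_i$, or a $(\sigma_i\cup\sigma_j)$-group for some different $\sigma_i,\sigma_j\in\sigma$ such that $p\in\sigma_i$.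
   Context: All groups are finite. $\pi(G)$ denotes the set of all primes dividing $|G|$. $\sigma=\{\sigma_i\mid i\in I\}$ is a partition of the set $\mathbb{P}$ of all primes, i.e. $\mathbb{P}=\bigcup_{i\in I}\sigma_i$ and $\sigma_i\cap\sigma_j=\emptyset$ for all $i\neq j$; $|\sigma|$ is the number of its parts. For a set $\pi$ of primes, a $\pi$-group is a group whose order is divisible only by primes in $\pi$, and a Hall $\pi$-subgroup of $G$ is a $\pi$-subgroup whose index in $G$ is divisible by no prime in $\pi$. Two subgroups $A$, $B$ of $G$ are permutable if $AB=BA$. A set $\mathcal{H}$ of subgroups of $G$ is a complete Hall $\sigma$-set of $G$ if every member $\neq 1$ of $\mathcal{H}$ is a Hall $\sigma_i$-subgroup of $G$ for some $i\in I$, and $\mathcal{H}$ contains exactly one Hall $\sigma_i$-subgroup of $G$ for every $i$ such that $\sigma_i\cap\pi(G)\neq\emptyset$. A complete Hall $\sigma$-set $\mathcal{H}$ of $G$ is a $\sigma$-basis of $G$ if every two members of $\mathcal{H}$ are permutable. For a chief factor $H/K$ of $G$, $C_G(H/K)$ denotes the kernel of the conjugation action of $G$ on $H/K$. For a class of groups $\mathfrak{F}$ (closed under isomorphism) containing the trivial group, $G^{\mathfrak{F}}$ denotes the intersection of all normal subgroups $N$ of $G$ with $G/N\in\mathfrak{F}$. Such a class $\mathfrak{F}$ is a formation if, for every group $G$, every homomorphic image of $G/G^{\mathfrak{F}}$ belongs to $\mathfrak{F}$. A formation $\mathfrak{F}$ is saturated if $G\in\mathfrak{F}$ whenever $G^{\mathfrak{F}}\leq\Phi(G)$,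 where $\Phi(G)$ is the Frattini subgroup of $G$; it is hereditary if $G\in\mathfrak{F}$ whenever $G\leq A\in\mathfrak{F}$.
   Formalization: Part (2) is stated under the assumption that |σ| ≥ 2; for |σ| = 1 it is false as written, since a group of order p lies in the class but no part omits p and there are no two different parts. *)

(* Defs.v *)
From mathcomp Require Export all_boot all_fingroup all_solvable.
From mathcomp Require Export boolp classical_sets cardinality.

Set Implicit Arguments.
Unset Strict Implicit.
Unset Printing Implicit Defensive.

(* [finset] and [classical_sets] both export the name [partition]; the one on
   families of classical sets asks for nonempty, pairwise disjoint members
   with the given union. *)
Definition prime_partition (I : Type) (sigma : I -> nat_pred) : Prop :=
  classical_sets.partition [set: I]%classic
    (fun i => [set p | p \in sigma i]%classic) [set p | prime p]%classic.

Local Open Scope group_scope.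

Definition group_class := forall gT : finGroupType, {group gT} -> Prop.

Definition iso_closed (F : group_class) : Prop :=
  forall (gT rT : finGroupType) (G : {group gT}) (H : {group rT}),
    G \isog H -> F gT G -> F rT H.

Definition residual (F : group_class) (gT : finGroupType) (G : {group gT}) :
    {group gT} :=
  [group of \bigcap_(N : {group gT} | (N <| G) && `[< F _ (G / N)%G >]) N].

Definition formation (F : group_class) : Prop :=
  [/\ iso_closed F,
      forall gT : finGroupType, F gT 1%G
    & forall (gT rT : finGroupType) (G : {group gT})
        (f : {morphism G / residual F G >-> rT}),
        F rT (f @* (G / residual F G))%G].

Definition saturated (F : group_class) : Prop :=
  forall (gT : finGroupType) (G : {group gT}),
    residual F G \subset 'Phi(G) -> F gT G.

Definition hereditary (F : group_class) : Prop :=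
  forall (gT : finGroupType) (G A : {group gT}),
    G \subset A -> F gT A -> F gT G.

Section HallSets.

Variables (I : Type) (sigma : I -> nat_pred).

(* The trivial subgroup may or may not be a member. *)
Definition complete_Hall_set (gT : finGroupType) (G : {group gT})
    (HH : {set {group gT}}) : Prop :=
  [/\ forall H : {group gT}, H \in HH -> H \subset G,
      forall H : {group gT}, H \in HH -> H :!=: 1 ->
        exists i, (sigma i).-Hall(G) H
    & forall i, (exists2 p, p \in sigma i & p \in \pi(G)) ->
        exists! H : {group gT}, H \in HH /\ (sigma i).-Hall(G) H].

Definition sigma_basis (gT : finGroupType) (G : {group gT})
    (HH : {set {group gT}}) : Prop :=
  complete_Hall_set G HH /\
  forall A B : {group gT}, A \in HH -> B \in HH -> A * B = B * A.

Definition Hclass : group_class := fun gT G =>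
  solvable G /\
  forall HH : {set {group gT}}, complete_Hall_set G HH -> sigma_basis G HH.

End HallSets.

(* [chief_factor G K H] reads: H / K is a chief factor of G.  The
   centraliser of H / K in G for the conjugation action ['Q] on cosets is
   the kernel of that action, all of G acting since K is normal in G. *)
Definition induced_aut (gT : finGroupType) (G H K : {group gT}) :=
  (G / 'C_G(H / K | 'Q))%G.

(* Main.v *)
(* A soluble group G lies in H_sigma if and only if, for all i <> j, every
   sigma_i-subgroup A and sigma_j-subgroup B of G generate a
   (sigma_i U sigma_j)-group.  In this form the property is visibly inherited
   by subgroups, images and subdirect products.

   Let V be an abelian normal subgroup whose order is prime to sigma_i and
   sigma_j.  For v in V, the group <A, B^v> is conjugate under V into the
   complement <A, B> of V in V<A, B>, whence V = C_V(A) C_V(B).  By induction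
   on V, splitting V along the action of some O_q(<A, B> / C(V)), this gives
   [V, B, A] = 1.  Applied to all conjugates of A this forces A or B to
   centralise V when V is minimal normal, so at most one block besides that
   of p divides the order of the group induced on a chief factor of p-power
   order.  Conversely, descending along a chief series, if A or B centralises
   the chief p-factor then both lie in one Hall (sigma_i U sigma_j)-subgroup
   of V<A, B>.

   For p, q, r in three different blocks and a finite field of characteristic
   p with elements alpha, beta of orders q, r, let G be the group of matrices
   [[s, x, z], [0, 1, y], [0, 0, t]] with s in <alpha> and t in <beta>.  Its
   corner subgroup {z} lies in Phi(G) and contains the intersection of two
   normal subgroups with a {p, q}- and a {p, r}-quotient, but an element of
   order q and one of order r have a nontrivial commutator in the corner. *)

Require Import Defs.
From HB Require Import structures.
From mathcomp Require Import ssralg finalg finfield ring.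
From mathcomp Require Import functions fintype finset.

Set Implicit Arguments.
Unset Strict Implicit.
Unset Printing Implicit Defensive.

Import GRing.Theory.
Local Open Scope group_scope.
Local Open Scope card_scope.

(** * Subgroups generated by a pi-subgroup and a rho-subgroup *)

Section JoinClosed.

Variables pi rho : nat_pred.
Implicit Types gT rT : finGroupType.

Definition join_closed gT (G : {group gT}) : Prop :=
  forall A B : {group gT}, A \subset G -> B \subset G ->
    pi.-group A -> rho.-group B -> [predU pi & rho].-group (A <*> B).

(** An elementwise test, convenient for intersections of normal subgroups. If [N] contains the
    [pi^']-part of [x], then [x] and its [pi]-part have the same coset, and Cauchy's theorem
    excludes primes outside [pi]. *)
Lemma pgroup_quotientP gT (X N : {group gT}) : X \subset 'N(N) ->
  pi.-group (X / N) <-> {in X, forall x, pi^'.-elt x -> x \in N}.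
Proof.
move=> nNX; split=> [piXN x Xx pi'x | sXN].
  have nNx := subsetP nNX x Xx.
  apply: coset_idr => //; apply/eqP; rewrite -order_eq1.
  apply/eqP; apply: (@pnat_1 pi); first exact: mem_p_elt piXN (mem_quotient N Xx).
  exact: morph_p_elt.
apply/pgroupP=> p p_pr /Cauchy[]// _ /morphimP[x nNx Xx ->] ox.
have pi_x : pi.-elt (coset N x).
  have -> : coset N x = coset N x.`_pi.
    rewrite -[x in LHS](consttC pi x) morphM ?groupX //.
    by rewrite /= [X in _ * X]coset_id ?mulg1 // sXN ?groupX ?p_elt_constt.
  by rewrite morph_p_elt ?groupX ?p_elt_constt.
by move: pi_x; rewrite /p_elt ox pnatE.
Qed.

Lemma join_closedS gT (G A : {group gT}) :
  G \subset A -> join_closed A -> join_closed G.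
Proof.
move=> sGA clA X Y sXG sYG; apply: clA; exact: subset_trans sGA.
Qed.

(** By solubility Hall subgroups of [G] map onto Hall subgroups of the image, so every [pi]- or
    [rho]-subgroup of the image is covered by one of [G]. *)
Lemma join_closed_morphim gT rT (D G : {group gT}) (f : {morphism D >-> rT}) :
  G \subset D -> solvable G -> join_closed G -> join_closed (f @* G).
Proof.
move=> sGD solG clG A B sA sB piA rhoB.
have lift (tau : nat_pred) (X : {group rT}) :
    X \subset f @* G -> tau.-group X ->
  exists Y : {group gT}, [/\ Y \subset G, tau.-group Y & X \subset f @* Y].
  move=> sX tauX; have [H hallH] := Hall_exists tau solG.
  have hallfH := morphim_pHall f (subset_trans (pHall_sub hallH) sGD) hallH.
  have [y /morphimP[x Dx Gx ->] sXH] :=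
    Hall_subJ (morphim_sol f solG) hallfH sX tauX.
  exists (H :^ x)%G; split.
  - by rewrite conj_subG // (pHall_sub hallH).
  - by rewrite pgroupJ (pHall_pgroup hallH).
  by rewrite morphimJ // (subset_trans (pHall_sub hallH)).
have [A1 [sA1 piA1 sAA1]] := lift _ _ sA piA.
have [B1 [sB1 rhoB1 sBB1]] := lift _ _ sB rhoB.
apply: pgroupS (morphim_pgroup f (clG A1 B1 sA1 sB1 piA1 rhoB1)).
by rewrite /= morphimY ?(subset_trans _ sGD) // genS // setUSS.
Qed.

End JoinClosed.

(** Closure under subdirect products: an element of the join whose order avoids both sets of primes
    lies in each [N], hence in [R]. *)
Lemma join_quotient_bigcap pi rho (gT : finGroupType) (G R : {group gT})
    (P : pred {group gT}) :
    R <| G -> R :=: \bigcap_(N : {group gT} | P N) N ->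
    (forall N, P N -> N <| G /\ join_closed pi rho (G / N)) ->
  join_closed pi rho (G / R).
Proof.
move=> nsRG defR clN Ab Bb sAG sBG piA rhoB.
have nRG := normal_norm nsRG.
have lift (X : {group coset_of R}) : X \subset G / R ->
    exists2 Y : {group gT}, Y \subset G & X = (Y / R)%G.
  move=> sX; have /andP[_ nR] := nsRG.
  have [Y eY sY sYG] := inv_quotientS nsRG sX.
  by exists Y => //; apply: val_inj.
have [A sA defA] := lift Ab sAG; have [B sB defB] := lift Bb sBG.
subst Ab Bb.
have nRA := subset_trans sA nRG; have nRB := subset_trans sB nRG.
have sAB : A <*> B \subset G by rewrite join_subG sA.
rewrite -quotientY //; apply/pgroup_quotientP.
  by rewrite join_subG nRA.
move=> x ABx pi'x; rewrite defR; apply/bigcapP => N PN.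
have [nsNG clGN] := clN N PN.
have sRN : R \subset N by rewrite defR bigcap_inf.
have down (tau : nat_pred) (X : {group gT}) : X \subset G ->
    tau.-group (X / R) -> tau.-group (X / N).
  move=> sXG; rewrite !pgroup_quotientP //.
  - by move=> tX y Xy /(tX y Xy); apply: subsetP.
  - exact: subset_trans (normal_norm nsNG).
  - exact: subset_trans nRG.
have nNAB : A <*> B \subset 'N(N) by apply: subset_trans (normal_norm nsNG).
have := clGN (A / N)%G (B / N)%G.
rewrite -quotientY ?(subset_trans _ (normal_norm nsNG)) //.
move=> /(_ (quotientS _ sA) (quotientS _ sB) (down _ _ sA piA) (down _ _ sB rhoB)).
by move/pgroup_quotientP => -> //.
Qed.

(** [solvable] says that only the trivial subgroup lies in its own derived subgroup. A subgroup of
    [G / R] lying in its derived subgroup has images of the same kind in every [G / N], so its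
    preimage lies in every [N]. *)
Lemma solvable_quotient_bigcap (gT : finGroupType) (G R : {group gT})
    (P : pred {group gT}) :
    R <| G -> R :=: \bigcap_(N : {group gT} | P N) N ->
    (forall N, P N -> N <| G /\ solvable (G / N)) ->
  solvable (G / R).
Proof.
move=> nsRG defR solN; apply/forallP => Hb; apply/implyP.
rewrite subsetI => /andP[sHG sHH'].
have [H defH sRH sH] := inv_quotientS nsRG sHG.
have nRH := subset_trans sH (normal_norm nsRG).
rewrite defH in sHH' *.
rewrite -quotientR // in sHH'.
rewrite -subG1 quotient_sub1 // defR; apply/bigcapsP => N PN.
have [nsNG solGN] := solN N PN.
have sRN : R \subset N by rewrite defR bigcap_inf.
have nNH := subset_trans sH (normal_norm nsNG).
rewrite -quotient_sub1 // subG1.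
have /forallP/(_ (H / N)%G)/implyP := solGN; apply.
rewrite subsetI quotientS //= -quotientR //.
have sHR : H \subset R * [~: H, H].
  by rewrite -quotientSK.
by rewrite quotientSK // (subset_trans sHR) // mulSg.
Qed.

Lemma mulG_Hall_predU (pi rho : nat_pred) (gT : finGroupType)
    (A B Y : {group gT}) :
    {in pi, forall p, p \notin rho} -> [predU pi & rho].-group Y ->
    pi.-Hall(Y) A -> rho.-Hall(Y) B ->
  A * B = Y.
Proof.
move=> dis piY hA hB; apply/eqP; rewrite eqEcard.
rewrite mul_subG ?(pHall_sub hA) ?(pHall_sub hB) //=.
have co : coprime #|A| #|B|.
  apply: (@pnat_coprime pi); first exact: pHall_pgroup hA.
  apply: sub_in_pnat (pHall_pgroup hB) => p _ rp; apply/negP => pp.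
  by have := dis p pp; rewrite rp.
rewrite coprime_cardMg // (card_Hall hA) (card_Hall hB).
rewrite -{1}(partnC pi (cardG_gt0 Y)) leq_mul2l; apply/orP; right.
(* Among the primes of [Y], those outside [pi] are exactly those in [rho]. *)
rewrite (@eq_in_partn (pi^') rho) // => p piYp; rewrite !inE.
have := pnatPpi piY piYp; rewrite !inE.
by case: (boolP (p \in pi)) => [/dis/negbTE->|_].
Qed.

(** * The class in terms of joins of subgroups from two blocks *)

Section Sigma.

Variables (I : Type) (sigma : I -> nat_pred).
Hypothesis sigmaP : prime_partition sigma.

Lemma sigma_inj i j p : p \in sigma i -> p \in sigma j -> i = j.
Proof.
case: sigmaP => _ tI _ pi pj; apply: tI => //; by exists p; split.
Qed.

Lemma sigma_prime i p : p \in sigma i -> prime p.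
Proof.
case: sigmaP => cov _ _ pi.
have : (classical_sets.cover [set: I]%classic
  (fun i => [set p | p \in sigma i]%classic)) p by exists i.
by rewrite cov.
Qed.

Lemma sigma_cover p : prime p -> exists i, p \in sigma i.
Proof.
case: sigmaP => cov _ _ pr.
have : [set p | prime p]%classic p by [].
by rewrite -cov => -[i _ /= ip]; exists i.
Qed.

Lemma sigma_dis i j : i <> j -> {in sigma i, forall p, p \notin sigma j}.
Proof. by move=> nij p pi; apply/negP => /(sigma_inj pi). Qed.

Lemma sigma_nonempty i : exists2 p, prime p & p \in sigma i.
Proof.
case: sigmaP => _ _ /(_ i Logic.I)[p ip]; exists p => //; exact: sigma_prime ip.
Qed.

Section HclassP.

Variables (gT : finGroupType) (G : {group gT}).

Lemma complete_Hall_setP (f : I -> {group gT}) :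
  (forall i, (sigma i).-Hall(G) (f i)) ->
  complete_Hall_set sigma G [set H | `[< exists i, H = f i >]].
Proof.
move=> hallf; split=> [H | H | i [p ip piGp]].
- by rewrite inE => /asboolP[i ->]; apply: pHall_sub (hallf i).
- by rewrite inE => /asboolP[i ->] _; exists i.
exists (f i); split=> [|H [+ hallH]].
  by split=> //; rewrite inE; apply/asboolP; exists i.
rewrite inE => /asboolP[k defH]; rewrite defH in hallH *.
(* A prime of block [i] dividing [#|G|] also divides [#|f k|], which forces [k = i]. *)
have pifk : p \in \pi(f k) by rewrite /= (card_Hall hallH) pi_of_part // inE piGp.
by rewrite (sigma_inj ip (pnatPpi (pHall_pgroup (hallf k)) pifk)).
Qed.

(** Forwards, Hall subgroups containing [A] and [B] permute, and their product is a group whose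
    order involves only the two blocks. Backwards, members for different blocks are Hall subgroups
    of their join, and counting orders shows that their product is this join. *)
Lemma HclassP :
  Hclass sigma G <-> solvable G /\
    forall i j, i <> j -> join_closed (sigma i) (sigma j) G.
Proof.
split=> [] [solG HG]; split=> //.
  move=> i j nij A B sAG sBG piA piB.
  have [H hallH sAH] := Hall_superset solG sAG piA.
  have [L hallL sBL] := Hall_superset solG sBG piB.
  (* One complete Hall set is to contain both [H] and [L]; the other members are arbitrary. *)
  have /choice[f hallf] : forall k, exists F : {group gT},
    [/\ (sigma k).-Hall(G) F, k = i -> F = H & k = j -> F = L].
    move=> k; have [->|ni] := pselect (k = i); first by exists H.
    have [->|nj] := pselect (k = j); first by exists L; split=> // /esym.
    by have [F hF] := Hall_exists (sigma k) solG; exists F.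
  have hf k : (sigma k).-Hall(G) (f k) by case: (hallf k).
  have [_ /(_ H L)] := HG _ (complete_Hall_setP hf).
  rewrite !inE => comHL.
  have {}comHL : H * L = L * H.
    apply: comHL; apply/asboolP; [exists i | exists j].
      by case: (hallf i) => _ ->.
    by case: (hallf j) => _ _ ->.
  have sAB : A <*> B \subset H <*> L by rewrite genS // setUSS.
  apply: (pgroupS sAB); rewrite /= comm_joingE //.
  have : [predU sigma i & sigma j].-nat (#|H| * #|L|)%N.
    rewrite pnatM; apply/andP; split.
      by apply: sub_in_pnat (pHall_pgroup hallH) => p _; rewrite !inE => ->.
    by apply: sub_in_pnat (pHall_pgroup hallL) => p _; rewrite !inE orbC => ->.
  by rewrite mul_cardG pnatM => /andP[].
move=> HH cHH; split=> // A B HA HB.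
case: cHH => sHH hallHH uHH.
have [-> | ntA] := eqVneq (A :> {set gT}) 1; first by rewrite mulg1 mul1g.
have [-> | ntB] := eqVneq (B :> {set gT}) 1; first by rewrite mulg1 mul1g.
have [i hA] := hallHH A HA ntA; have [j hB] := hallHH B HB ntB.
have [eij | nij] := pselect (i = j).
  (* Within one block, uniqueness in the complete Hall set gives [A = B]; the prime it requires
     comes from [A] being nontrivial. *)
  subst j; have : exists2 p, p \in sigma i & p \in \pi(G).
    have [p pA] : exists p, p \in \pi(A).
      by exists (pdiv #|A|); rewrite pi_pdiv cardG_gt1.
    exists p; first exact: pnatPpi (pHall_pgroup hA) pA.
    exact: (piSg (pHall_sub hA)).
  by case/uHH => F [_ uF]; rewrite -(uF A) // -(uF B).
have [sA sB] := (sHH A HA, sHH B HB).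
have piY := HG i j nij A B sA sB (pHall_pgroup hA) (pHall_pgroup hB).
have sYG : A <*> B \subset G by rewrite join_subG sA.
have defY : A * B = A <*> B.
  apply: (@mulG_Hall_predU (sigma i) (sigma j) _ A B (A <*> B)%G) => //.
  - exact: sigma_dis.
  - exact: pHall_subl (joing_subl A B) sYG hA.
  - exact: pHall_subl (joing_subr A B) sYG hB.
apply/comm_group_setP; rewrite defY; exact: groupP.
Qed.

End HclassP.

End Sigma.

(** * Closure properties *)

Lemma inj_card_le_II (T : Type) n (f : T -> nat) :
  injective f -> (forall x, f x < n) -> [set: T]%classic #<= `I_n.
Proof.
move=> inj_f ltfn; have eqf : (f @` [set: T])%classic #= [set: T]%classic.
  by apply: inj_card_eq => x y _ _; apply: inj_f.
rewrite -(card_le_eql eqf); apply: subset_card_le => _ [x _ <-].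
exact: ltfn.
Qed.

(** For the converse, send a fixed [i0] to 0 and everything else to 1; injectivity is the condition
    on three indices. *)
Lemma card_le_I2P (T : Type) :
  [set: T]%classic #<= `I_2 <-> forall i j k : T, [\/ i = j, j = k | i = k].
Proof.
split=> [/pcard_leP/unsquash f i j k | small].
  have inj x y : f x = f y -> x = y by apply: inj; apply: mem_set.
  have bnd x : f x < 2 := @functions.funS _ _ _ _ f x Logic.I.
  have := bnd i; have := bnd j; have := bnd k.
  case Ek: (f k) => [|[|?]] // _; case Ej: (f j) => [|[|?]] // _;
    case Ei: (f i) => [|[|?]] // _;
    first [ by constructor 1; apply: inj; rewrite Ei Ej
          | by constructor 2; apply: inj; rewrite Ej Ek
          | by constructor 3; apply: inj; rewrite Ei Ek].
have [[i0 _] | noT] := pselect (exists i : T, True); last first.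
  by apply: (@inj_card_le_II _ _ (fun=> 0)) => x; case: noT; exists x.
apply: (@inj_card_le_II _ _ (fun x => ~~ `[< x = i0 >])) => [x y|x].
  case: asboolP => [->|nx]; case: asboolP => // ny _.
  by case: (small x y i0).
by case: asboolP.
Qed.

Lemma I2_card_leP (T : Type) :
  `I_2 #<= [set: T]%classic -> exists i j : T, i <> j.
Proof.
move=> le2T; apply: contrapT => no2.
have: `I_2 #<= `I_1; last by rewrite card_le_II.
apply: card_le_trans le2T _; apply: (@inj_card_le_II _ _ (fun=> 0)) => // x y _.
by apply: contrapT => nxy; apply: no2; exists x, y.
Qed.

(** Frattini argument: for a Sylow subgroup [P] of the Frattini subgroup, the latter and ['N_G(P)]
    generate [G], so ['N_G(P) = G] and [P] lies in the Fitting subgroup. *)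
Lemma Phi_nilpotent (gT : finGroupType) (G : {group gT}) : nilpotent 'Phi(G).
Proof.
apply: nilpotentS (Fitting_nil G).
rewrite -{1}(Sylow_gen 'Phi(G)%G) gen_subG; apply/bigcupsP => P /SylowP[p _ sylP].
have sPG := subset_trans (pHall_sub sylP) (Phi_sub G).
have defG : 'N_G(P) = G.
  rewrite -[RHS](@Phi_nongen _ G 'N_G(P)) ?genGid //.
  rewrite norm_joinEr; first exact: Frattini_arg (Phi_normal G) sylP.
  exact: subset_trans (subsetIl _ _) (normal_norm (Phi_normal G)).
apply: Fitting_max (pgroup_nil (pHall_pgroup sylP)).
by rewrite /normal sPG -{1}defG subsetIr.
Qed.

(** The hypothesis puts [G] itself among the intersected subgroups; an empty intersection would be
    the whole type. *)
Lemma residual_normal (F : group_class) (gT : finGroupType) (G : {group gT}) :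
  F _ (G / G)%G -> residual F G <| G.
Proof.
move=> FGG; apply/andP; split.
  by apply: (bigcap_inf G); rewrite normal_refl; apply/asboolP.
rewrite /=; elim/big_ind: _ => [|X Y nX nY|N /andP[/andP[]]//].
  by rewrite (subset_trans (subsetT G)) // normT.
exact: normsI.
Qed.

Section Sigma.

Variables (I : Type) (sigma : I -> nat_pred).
Hypothesis sigmaP : prime_partition sigma.

Let classP := @HclassP _ _ sigmaP.

Lemma Hclass_hereditary : hereditary (Hclass sigma).
Proof.
move=> gT G A sGA /classP[solA clA]; apply/classP.
split=> [|i j nij]; first exact: solvableS solA.
by apply: join_closedS sGA _; apply: clA.
Qed.

Lemma Hclass_morphim (gT rT : finGroupType) (D G : {group gT})
    (f : {morphism D >-> rT}) :
  G \subset D -> Hclass sigma G -> Hclass sigma (f @* G)%G.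
Proof.
move=> sGD /classP[solG clG]; apply/classP; split=> [|i j nij].
  exact: morphim_sol.
by apply: join_closed_morphim => //; apply: clG.
Qed.

Lemma Hclass1 (gT : finGroupType) : Hclass sigma (1%G : {group gT}).
Proof.
apply/classP; split=> [|i j _ A B sA sB _ _]; first exact: solvable1.
by apply: (@pgroupS _ _ 1%G); rewrite ?pgroup1 // join_subG sA.
Qed.

Lemma Hclass_isog (gT rT : finGroupType) (G : {group gT}) (H : {group rT}) :
  G \isog H -> Hclass sigma G -> Hclass sigma H.
Proof.
case/isogP=> f _ defH cG; have -> : H = (f @* G)%G by apply: val_inj.
exact: Hclass_morphim.
Qed.

Lemma Hclass_residual_normal (gT : finGroupType) (G : {group gT}) :
  residual (Hclass sigma) G <| G.
Proof.
apply: residual_normal; have -> : (G / G)%G = 1%G.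
  by apply: val_inj; rewrite /= trivg_quotient.
exact: Hclass1.
Qed.

Lemma Hclass_residual (gT : finGroupType) (G : {group gT}) :
  Hclass sigma (G / residual (Hclass sigma) G)%G.
Proof.
have nsRG := Hclass_residual_normal G.
apply/classP; split=> [|i j nij].
  apply: solvable_quotient_bigcap nsRG (erefl _) _ => N.
  by case/andP=> nsN /asboolP/classP[].
apply: join_quotient_bigcap nsRG (erefl _) _ => N.
by case/andP=> nsN /asboolP/classP[_ clN]; split=> //; apply: clN.
Qed.

Lemma Hclass_formation : formation (Hclass sigma).
Proof.
split; [exact: Hclass_isog | exact: Hclass1 |].
by move=> gT rT G f; apply: Hclass_morphim (Hclass_residual G).
Qed.

(** Subgroups belonging to a third block are trivial here, so a join is either a subgroup of [G] for
    the blocks [i], [j] or one of its two factors. This handles the two quotients of the matrix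
    group below. *)
Lemma Hclass_predU (gT : finGroupType) (G : {group gT}) i j :
  solvable G -> [predU sigma i & sigma j].-group G -> Hclass sigma G.
Proof.
move=> solG piG; apply/classP; split=> // k l nkl A B sA sB piA piB.
have trivX m (X : {group gT}) :
    X \subset G -> (sigma m).-group X -> m <> i -> m <> j -> X :=: 1.
  move=> sXG piX nmi nmj; apply: card1_trivg.
  apply: (@pnat_1 (sigma m)) => //; apply: sub_in_pnat (pgroupS sXG piG) => p _.
  rewrite !inE => /orP[] pi; apply: (@sigma_dis _ _ sigmaP _ m) pi;
    exact: nesym.
have [ki | nki] := pselect (k = i).
  have [lj | nlj] := pselect (l = j).
    by rewrite ki lj; apply: pgroupS piG; rewrite join_subG sA.
  rewrite (trivX l B) // => [|li]; last by apply: nkl; rewrite ki li.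
  rewrite joingG1; apply: sub_in_pnat piA => p _; rewrite !inE => ->; done.
have [kj | nkj] := pselect (k = j); last first.
  rewrite (trivX k A) // joing1G; apply: sub_in_pnat piB => p _.
  by rewrite !inE orbC => ->.
have [li | nli] := pselect (l = i).
  rewrite kj li; apply: sub_in_pnat (pgroupS _ piG) => [p _|].
    by rewrite !inE orbC.
  by rewrite join_subG sA.
rewrite (trivX l B) // => [|lj]; last by apply: nkl; rewrite kj lj.
by rewrite joingG1; apply: sub_in_pnat piA => p _; rewrite !inE => ->.
Qed.

(** Two different blocks now contain all primes, so joins impose no condition and only solubility is
    at stake; it passes from the residual quotient to [G] because the Frattini subgroup is
    nilpotent. *)
Lemma saturated_le2 : [set: I]%classic #<= `I_2 -> saturated (Hclass sigma).
Proof.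
move=> /card_le_I2P small gT G sRPhi; apply/classP.
have nsRG := Hclass_residual_normal G.
have /classP[solGR _] := Hclass_residual G.
split=> [|i j nij A B sA sB piA piB].
  rewrite (series_sol nsRG) solGR andbT nilpotent_sol //.
  exact: nilpotentS sRPhi (Phi_nilpotent G).
apply/pgroupP => p p_pr _; have [k pk] := sigma_cover sigmaP p_pr.
by rewrite !inE; case: (small i j k) => [/nij// | -> | ->]; rewrite pk ?orbT.
Qed.

End Sigma.

(** * Chief factors *)

Lemma joining_Hall (tau : nat_pred) (gT : finGroupType) (V Y : {group gT}) :
  Y \subset 'N(V) -> tau^'.-group V -> tau.-group Y -> tau.-Hall(V <*> Y) Y.
Proof.
move=> nVY tau'V tauY; rewrite /pHall joing_subr tauY /=.
have co : coprime #|V| #|Y| by rewrite coprime_sym (pnat_coprime tauY).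
by rewrite -divgS ?joing_subr //= norm_joinEr // coprime_cardMg // mulnK.
Qed.

Lemma pcore_solvable_neq1 (gT : finGroupType) (G : {group gT}) :
  solvable G -> G :!=: 1 -> exists2 q, q \in \pi(G) & 'O_q(G) != 1.
Proof.
move=> solG ntG; have ntF : 'F(G) != 1 by rewrite trivg_Fitting.
pose q := pdiv #|'F(G)|; have piFq : q \in \pi('F(G)) by rewrite pi_pdiv cardG_gt1.
exists q; first by apply: (piSg (Fitting_sub G)).
rewrite -p_core_Fitting; apply/eqP => O1.
have := card_Hall (nilpotent_pcore_Hall q (Fitting_nil G)).
rewrite /= O1 cards1 => /esym/eqP; rewrite p_part_eq1.
by move/negP; apply.
Qed.

(** A Hall subgroup of [Y / C] for a set containing [q] contains ['O_q(Y / C)]; pull this back to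
    [Y]. *)
Lemma Hall_cover_normal (gT : finGroupType) (sg : nat_pred)
    (Y N C H : {group gT}) (q : nat) :
    C <| Y -> C \subset N -> N / C = 'O_q(Y / C) -> q \in sg -> N \subset Y ->
    sg.-Hall(Y) H ->
  N \subset C * H.
Proof.
move=> nsCY sCN defN sgq sNY hallH; have nCY := normal_norm nsCY.
have nCH := subset_trans (pHall_sub hallH) nCY.
rewrite -quotientSK ?(subset_trans sNY) // defN.
apply: subset_trans (pcore_sub_Hall (quotient_pHall nCH hallH)).
apply: pcore_max (pcore_normal q _).
by apply: sub_in_pnat (pcore_pgroup q _) => r _ /eqnP->.
Qed.

(** * Joins acting on a normal subgroup of coprime order *)

Section JoinAction.

Variables (pi rho : nat_pred) (gT : finGroupType).
Let tau := [predU pi & rho].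
Implicit Types G V A B : {group gT}.

Lemma join_closed_cent_prod G V A B :
    solvable G -> join_closed pi rho G -> V \subset G -> tau^'.-group V ->
    A \subset G -> B \subset G -> A <*> B \subset 'N(V) ->
    pi.-group A -> rho.-group B ->
  V \subset 'C_V(B) * 'C_V(A).
Proof.
move=> solG clG sVG tau'V sAG sBG nVY piA rhoB.
set Y := (A <*> B)%G; have sYG : Y \subset G by rewrite join_subG sAG.
have tauY : tau.-group Y by apply: clG.
have tiVY : V :&: Y = 1 by apply: coprime_TIg; rewrite coprime_sym (pnat_coprime tauY).
have hallY := joining_Hall nVY tau'V tauY.
have sVYG : V <*> Y \subset G by rewrite join_subG sVG.
(* For [k] in [K], the commutator of [w] and [k] lies in both [V] and [Y], which meet trivially. *)
have conj_cent (K : {group gT}) w : K \subset Y -> w \in V -> K :^ w \subset Y ->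
    w \in 'C(K).
  move=> sKY Vw sKwY; apply/centP=> k Kk; apply/esym/commgP.
  have nVk := subsetP (subset_trans sKY nVY) k Kk.
  rewrite -in_set1 -[[set 1]]tiVY inE; apply/andP; split.
    by rewrite commgEr groupM // memJ_norm ?groupV.
  rewrite commgEl groupM ?groupV //; first exact: subsetP sKY _ Kk.
  by rewrite (subsetP sKwY) // memJ_conjg.
apply/subsetP => v Vv.
have rhoBv : rho.-group (B :^ v) by rewrite pgroupJ.
have sBvG : B :^ v \subset G by rewrite conj_subG // (subsetP sVG).
have tauZ := clG A (B :^ v)%G sAG sBvG piA rhoBv.
have sZ : A <*> B :^ v \subset V <*> Y.
  rewrite join_subG (subset_trans _ (joing_subr V Y)) ?joing_subl //=.
  rewrite conj_subG ?(subsetP (joing_subl V Y)) //.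
  by rewrite (subset_trans _ (joing_subr V Y)) ?joing_subr.
have [z] := Hall_subJ (solvableS sVYG solG) hallY sZ tauZ.
(* The conjugating element is [y * w] with [y] in [Y] and [w] in [V], and [y] normalises [Y]. Then
   [w] centralises [A], [v * w^-1] centralises [B], and [v] is the product of [v * w^-1] and [w]. *)
rewrite /= (norm_joinEr nVY) -(normC nVY) => /mulsgP[y w Yy Vw ->{z}].
rewrite conjsgM (conjGid Yy) join_subG => /andP[sAw sBvw].
have cAw : w \in 'C(A).
  rewrite -groupV; apply: conj_cent; rewrite ?groupV ?joing_subl //.
  by rewrite sub_conjgV.
have cBvw : v * w^-1 \in 'C(B).
  apply: conj_cent; rewrite ?groupM ?groupV ?joing_subr //.
  by rewrite conjsgM sub_conjgV.
rewrite -(mulgKV w v); apply: mem_mulg; rewrite inE ?Vw ?cAw //.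
by rewrite groupM ?groupV.
Qed.

(** If [Y] acts nontrivially, let [N] be the preimage in [Y] of a nontrivial ['O_q(Y / 'C_Y(V))].
    Induction treats ['C_V(N)], and the factorisation by centralisers treats [[~: V, N]], on which
    [N] has no nontrivial fixed point. *)
Lemma join_closed_commg_cent G V A B :
    solvable G -> join_closed pi rho G -> V \subset G -> tau^'.-group V ->
    A \subset G -> B \subset G -> A <*> B \subset 'N(V) -> abelian V ->
    pi.-group A -> rho.-group B ->
  A \subset 'C([~: V, B]).
Proof.
move=> solG clG; have [n] := ubnP #|V|; elim: n V => // n IHn V /ltnSE leVn.
move=> sVG tau'V sAG sBG nVY abV piA rhoB.
set Y := (A <*> B)%G in nVY *; have sYG : Y \subset G by rewrite join_subG sAG.
have tauY : tau.-group Y by apply: clG.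
have [sAY sBY] : A \subset Y /\ B \subset Y by rewrite joing_subl joing_subr.
have solY := solvableS sYG solG.
have nsCY : 'C_Y(V) <| Y by rewrite /normal subsetIl normsI ?normG ?norms_cent.
have [sYC | nsYC] := boolP (Y \subset 'C_Y(V)).
  suff -> : [~: V, B] = 1 by apply: cents1.
  apply/commG1P; rewrite centsC (subset_trans sBY) //.
  by case/subsetIP: sYC.
have ntYC : (Y / 'C_Y(V))%G :!=: 1.
  by rewrite -subG1 quotient_sub1 ?normal_norm.
have [q piq ntO] := pcore_solvable_neq1 (quotient_sol _ solY) ntYC.
have tauq : q \in tau.
  by apply: (pnatPpi (quotient_pgroup _ tauY)) piq.
have [N defN sCN nsNY] := inv_quotientN nsCY (pcore_normal q (Y / 'C_Y(V))).
have nVN := subset_trans (normal_sub nsNY) nVY.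
have coVN : coprime #|V| #|N|.
  by rewrite coprime_sym (pnat_coprime (pgroupS (normal_sub nsNY) tauY)).
set U := [~: V, N]%G; set V1 := 'C_V(N)%G.
have nUY : Y \subset 'N(U) by rewrite normsR // normal_norm.
have sUV : U \subset V by rewrite commg_subl.
have tiU : 'C_U(N) = 1 by apply: coprime_abel_cent_TI.
(* A Hall subgroup whose primes include [q] covers [N] modulo the kernel of the action, so it
   inherits the absence of fixed points on [U]. *)
have cover (K : {group gT}) (sg : nat_pred) :
    K \subset Y -> sg.-Hall(Y) K -> q \in sg -> 'C_U(K) = 1.
  move=> sKY hallK sgq; apply/trivgP; rewrite -tiU subsetI subsetIl /= centsC.
  apply: subset_trans (Hall_cover_normal nsCY sCN (esym defN) sgq _ hallK) _.
    exact: normal_sub.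
  rewrite mul_subG //; last by rewrite centsC subsetIr.
  by rewrite subIset // orbC centS // subIset // sUV.
have nV1Y : Y \subset 'N(V1) by rewrite normsI // norms_cent // normal_norm.
(* [N] centralises [V / U], and fixed points lift along a coprime action. *)
have defV : U * V1 = V.
  apply/eqP; rewrite eqEsubset mul_subG ?subsetIl //=.
  have nUV : V \subset 'N(U) by rewrite sub_abelian_norm.
  rewrite -quotientSK // coprime_quotient_cent ?abelian_sol //; last first.
    by rewrite (subset_trans (normal_sub nsNY)).
  by rewrite subsetI subxx quotient_cents2r.
(* If [N] centralised [V], its image ['O_q(Y / 'C_Y(V))] would be trivial. *)
have ltV1 : #|V1| < n.
  apply: leq_trans leVn; apply: proper_card; rewrite properEneq subsetIl andbT.
  apply: contraNneq ntO => defV1; rewrite defN -subG1 quotient_sub1.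
    by rewrite subsetI normal_sub // centsC -defV1 subsetIr.
  exact: subset_trans (normal_sub nsNY) (normal_norm nsCY).
have cV1 : A \subset 'C([~: V1, B]).
  apply: IHn => //; first exact: subset_trans (subsetIl _ _) sVG.
  - exact: pgroupS (subsetIl _ _) tau'V.
  - exact: abelianS (subsetIl _ _) abV.
have cU : A \subset 'C([~: U, B]).
  have sUG := subset_trans sUV sVG.
  have tau'U := pgroupS sUV tau'V.
  (* If [q] is in [pi], enlarge [A] to a Hall subgroup of [Y]: its fixed points on [U] vanish, so
     [B] centralises [U]. If [q] is in [rho], the same with [B] enlarged shows that [A] centralises
     [U]. *)
  case/orP: tauq => [piq' | rhoq].
    have [A1 hallA1 sAA1] := Hall_superset solY sAY piA.
    have sA1Y := pHall_sub hallA1.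
    have /subset_trans-/(_ 'C(B)) sUB : U \subset 'C_U(B) * 'C_U(A1).
      apply: (join_closed_cent_prod solG clG) => //.
      - exact: subset_trans sYG.
      - by rewrite (subset_trans _ nUY) // join_subG sA1Y.
      - exact: pHall_pgroup hallA1.
    suff -> : [~: U, B] = 1 by apply: cents1.
    apply/commG1P/sUB; rewrite (cover A1 pi) ?mulg1 ?subsetIr //.
  have [B1 hallB1 sBB1] := Hall_superset solY sBY rhoB.
  have sB1Y := pHall_sub hallB1.
  have /subset_trans-/(_ 'C(A)) sUA : U \subset 'C_U(B1) * 'C_U(A).
    apply: (join_closed_cent_prod solG clG) => //.
    - exact: subset_trans sYG.
    - by rewrite (subset_trans _ nUY) // join_subG sAY.
    - exact: pHall_pgroup hallB1.
  apply: (@subset_trans _ _ 'C(U)).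
    by rewrite centsC sUA // (cover B1 rho) // mul1g subsetIr.
  by rewrite centS // commg_subl (subset_trans sBY).
rewrite -defV commMG; last first.
  apply: subset_trans (subsetIl _ _) (sub_abelian_norm abV _).
  by rewrite (subset_trans _ sUV) // commg_subl (subset_trans sBY).
by rewrite centM subsetI cU.
Qed.

End JoinAction.

(** Let [D] be the normal closure of [A]. By minimality ['C_V(D)] is [V] or trivial. In the second
    case [[~: V, B]], centralised by every conjugate of [A], lies in ['C_V(D)] and vanishes. *)
Lemma join_closed_minnormal (pi rho : nat_pred) (gT : finGroupType)
    (G V A B : {group gT}) :
    solvable G -> join_closed pi rho G -> minnormal V G -> V \subset G ->
    abelian V -> [predU pi & rho]^'.-group V ->
    A \subset G -> B \subset G -> pi.-group A -> rho.-group B ->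
  A \subset 'C(V) \/ B \subset 'C(V).
Proof.
move=> solG clG minV sVG abV tau'V sAG sBG piA rhoB.
have [/andP[ntV nVG] minV'] := mingroupP minV.
have nVAB (X Y : {group gT}) : X \subset G -> Y \subset G -> X <*> Y \subset 'N(V).
  by move=> sX sY; rewrite (subset_trans _ nVG) // join_subG sX.
set D := <<class_support A G>>.
have nDG : G \subset 'N(D) by rewrite norms_gen // class_support_norm.
have sAD : A \subset D by rewrite sub_gen // sub_class_support.
have [CV1 | ntCV] := eqVneq 'C_V(D) 1; last first.
  left; rewrite centsC -(minV' 'C_V(D)%G _ (subsetIl _ _)) ?subIset ?centS ?orbT //.
  by rewrite ntCV normsI // norms_cent.
right; rewrite centsC; apply/commG1P/trivgP; rewrite -CV1 subsetI.
rewrite commg_subl (subset_trans sBG nVG) /= cent_gen class_supportEr centsC.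
apply/bigcupsP => x Gx.
apply: (@join_closed_commg_cent pi rho _ G V (A :^ x)%G B) => //.
- by rewrite conj_subG.
- by apply: nVAB => //; rewrite conj_subG.
- by rewrite pgroupJ.
Qed.

(** Take a Hall [tau]-subgroup [Y] of [V <*> X] containing one factor. The other factor lies in a
    conjugate of [Y] by some [w] in [V]; if it centralises [V], conjugation by [w] fixes it, so it
    lies in [Y] too. *)
Lemma pgroup_join_over (pi rho : nat_pred) (gT : finGroupType)
    (G V A B : {group gT}) :
    let tau := [predU pi & rho] in
    solvable G -> V \subset G -> A \subset G -> B \subset G -> G \subset 'N(V) ->
    pi.-group A -> rho.-group B -> tau.-nat #|A <*> B : V| ->
    tau^'.-group V -> A \subset 'C(V) \/ B \subset 'C(V) ->
  tau.-group (A <*> B).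
Proof.
move=> tau solG sVG sAG sBG nVG piA rhoB tauXV tau'V.
set X := (A <*> B)%G; have sXG : X \subset G by rewrite join_subG sAG.
have nVX := subset_trans sXG nVG.
have sVXG : V <*> X \subset G by rewrite join_subG sVG.
have solVX := solvableS sVXG solG.
have hallV : (tau^').-Hall(V <*> X) V.
  rewrite /pHall joing_subl tau'V pnatNK /= -card_quotient.
    by rewrite quotientYidl // card_quotient.
  by rewrite join_subG normG.
have half (C D : {group gT}) :
    C \subset X -> D \subset X -> tau.-group C -> tau.-group D ->
    D \subset 'C(V) -> tau.-group (C <*> D).
  move=> sCX sDX tauC tauD cVD.
  have sXVX := joing_subr V X.
  have [Y hallY sCY] := Hall_superset solVX (subset_trans sCX sXVX) tauC.
  have [z] := Hall_subJ solVX hallY (subset_trans sDX sXVX) tauD.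
  have defVX : Y * V = V <*> X.
    apply: (@mulG_Hall_predU tau tau^' _ _ _ (V <*> X)%G) => //.
      by move=> p taup; rewrite !inE negbK.
    by apply/pgroupP=> p _ _; rewrite !inE orbN.
  rewrite /= -defVX => /mulsgP[y w Yy Vw ->{z}]; rewrite conjsgM (conjGid Yy).
  have defD : D :^ w = D.
    by apply/normP; apply: (subsetP (cent_sub _)); rewrite (subsetP _ w Vw) // centsC.
  rewrite -{1}defD conjSg => sDY; apply: pgroupS (pHall_pgroup hallY).
  by rewrite join_subG sCY.
have tauA : tau.-group A.
  by apply: sub_in_pnat piA => p _; rewrite !inE => ->.
have tauB : tau.-group B.
  by apply: sub_in_pnat rhoB => p _; rewrite !inE orbC => ->.
have sAX : A \subset X := joing_subl _ _; have sBX : B \subset X := joing_subr _ _.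
by case=> [cVA | cVB]; [rewrite joingC|]; apply: half.
Qed.

(** * Automorphism groups induced on chief factors *)

Section InducedAut.

Variables (gT : finGroupType) (G H K : {group gT}).
Hypothesis chiefHK : chief_factor G K H.

Let nKG : G \subset 'N(K).
Proof. by case/andP: chiefHK => /maxgroupp/andP[]. Qed.

Let nsKG : K <| G.
Proof.
case/andP: chiefHK => /maxgroupp/andP[/proper_sub sKH _] /normal_sub sHG.
by rewrite /normal nKG (subset_trans sKH).
Qed.

Lemma quotient_astabQ : 'C_G(H / K | 'Q) / K = 'C_(G / K)(H / K).
Proof. by rewrite astabQ quotientGI ?normal_sub // cosetpreK. Qed.

(** Third isomorphism theorem; in [G / K] the kernel of the action becomes an ordinary
    centraliser. *)
Lemma induced_aut_isog :
  (G / K) / 'C_(G / K)(H / K) \isog induced_aut G H K.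
Proof.
have nHbG : G / K \subset 'N(H / K).
  by case/andP: chiefHK => _ /normal_norm nHG; rewrite quotient_norms.
have sKC : K \subset 'C_G(H / K | 'Q).
  by rewrite subsetI normal_sub // astabQ -{1}(ker_coset K) kerE morphpreS ?sub1G.
have nsKC : K <| 'C_G(H / K | 'Q).
  by rewrite /normal sKC (subset_trans (subsetIl _ _)).
rewrite -quotient_astabQ; apply: third_isog => //.
rewrite -(quotientGK nsKG) -(quotientGK nsKC) cosetpre_normal.
by rewrite quotient_astabQ /normal subsetIl normsI ?normG ?norms_cent.
Qed.

Lemma induced_aut_pgroupP (pi : nat_pred) :
  pi.-group (induced_aut G H K) <->
  {in G / K, forall x, pi^'.-elt x -> x \in 'C(H / K)}.
Proof.
have nHbG : G / K \subset 'N(H / K).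
  by case/andP: chiefHK => _ /normal_norm nHG; rewrite quotient_norms.
rewrite -(isog_pgroup _ induced_aut_isog) /= pgroup_quotientP; last first.
  by rewrite normsI ?normG ?norms_cent.
by split=> C x Gx /(C x Gx); rewrite inE Gx.
Qed.

Lemma induced_aut_pgroup (pi : nat_pred) :
    (forall q, prime q -> q \notin pi ->
      {in G / K, forall x, q.-elt x -> x \in 'C(H / K)}) ->
  pi.-group (induced_aut G H K).
Proof.
move=> cq; apply/pgroupP=> q q_pr; apply: contraLR => pi'q.
rewrite -p'natE //; apply/induced_aut_pgroupP => x Gx q''x.
by apply: (cq q) => //; rewrite /p_elt -pnatNK.
Qed.

End InducedAut.

Lemma chief_factor_solvable (gT : finGroupType) (G H K : {group gT}) :
    solvable G -> chief_factor G K H ->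
  [/\ minnormal (H / K) (G / K), H / K \subset G / K & is_abelem (H / K)].
Proof.
move=> solG chiefHK; have sHG : H / K \subset G / K.
  by case/andP: chiefHK => _ /normal_sub; apply: quotientS.
have minV := chief_factor_minnormal chiefHK.
by have [_ _ abV] := minnormal_solvable minV sHG (quotient_sol K solG).
Qed.

(** * The chief factor criterion *)

Section Sigma.

Variables (I : Type) (sigma : I -> nat_pred).
Hypothesis sigmaP : prime_partition sigma.
Variables (gT : finGroupType) (G : {group gT}).

(** Of two elements from different blocks other than [k], one centralises [H / K]. The index [l]
    provides a first candidate for [j], so that some [j] exists even when the induced group is a
    [sigma k]-group. *)
Lemma Hclass_induced_aut (p : nat) (H K : {group gT}) k l :
    Hclass sigma G -> k <> l -> chief_factor G K H -> p \in sigma k ->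
    prime p -> p %| #|H / K| ->
  exists2 j, k <> j & [predU sigma k & sigma j].-group (induced_aut G H K).
Proof.
move=> /(HclassP sigmaP)[solG clG] nkl chiefHK pk p_pr pV.
have [minV sVG /is_abelemP[q q_pr abelV]] := chief_factor_solvable solG chiefHK.
have qp : p = q.
  by have := pgroupP (abelem_pgroup abelV) p p_pr pV; rewrite inE => /eqP.
rewrite -{q q_pr}qp in abelV.
have nKG : G \subset 'N(K) by case/andP: chiefHK => /maxgroupp/andP[].
have centr m n : k <> m -> k <> n -> m <> n ->
  forall x y, x \in G / K -> y \in G / K -> (sigma m).-elt x -> (sigma n).-elt y ->
    x \in 'C(H / K) \/ y \in 'C(H / K).
  move=> nkm nkn nmn x y Gx Gy mx ny; rewrite -2!cycle_subG.
  apply: (@join_closed_minnormal (sigma m) (sigma n) _ (G / K)%G) => //.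
  - exact: quotient_sol.
  - by apply: join_closed_morphim => //; apply: clG.
  - exact: abelem_abelian abelV.
  - apply: sub_in_pnat (abelem_pgroup abelV) => r _ /eqnP->.
    rewrite !inE negb_or (sigma_dis sigmaP nkm pk).
    exact: (sigma_dis sigmaP nkn pk).
  - by rewrite cycle_subG.
  - by rewrite cycle_subG.
apply: contrapT => noj.
have bad j : k <> j -> exists q x,
    [/\ prime q, q \notin [predU sigma k & sigma j], x \in G / K, q.-elt x
      & x \notin 'C(H / K)].
  move=> nkj; apply: contrapT => noq; apply: noj; exists j => //.
  apply: induced_aut_pgroup => // q q_pr nq x Gx qx.
  by apply: contrapT => /negP ncx; apply: noq; exists q, x.
have block q x : prime q -> q.-elt x -> exists2 m, q \in sigma m & (sigma m).-elt x.
  move=> /(sigma_cover sigmaP)[m mq] qx; exists m => //.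
  by apply: sub_in_pnat qx => r _ /eqnP->.
(* The failure of [l] yields a noncentralising [x] in a block [m] other than [k]; the failure of [m]
   then yields such a [y] in a block [n] other than [k] and [m]. *)
have [q [x [q_pr nq Gx qx ncx]]] := bad l nkl.
have [m qm mx] := block _ q x q_pr qx.
have nkm : k <> m by move=> km; rewrite !inE km qm in nq.
have [r [y [r_pr nr Gy ry ncy]]] := bad m nkm.
have [n rn ny] := block _ r y r_pr ry.
have nkn : k <> n by move=> kn; rewrite !inE kn rn in nr.
have nmn : m <> n by move=> mn; rewrite !inE mn rn orbT in nr.
have [cx | cy] := centr m n nkm nkn nmn x y Gx Gy mx ny.
  by case/negP: ncx.
by case/negP: ncy.
Qed.

Lemma induced_aut_Hclass :
    solvable G ->
    (forall (p : nat) (H K : {group gT}) k,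
       prime p -> chief_factor G K H -> p %| #|H / K| -> p \in sigma k ->
     exists2 j, k <> j & [predU sigma k & sigma j].-group (induced_aut G H K)) ->
  Hclass sigma G.
Proof.
move=> solG autG; apply/(HclassP sigmaP); split=> // i j nij A B sAG sBG piA rhoB.
set tau := [predU _ & _]; set X := (A <*> B)%G.
have sXG : X \subset G by rewrite join_subG sAG.
(* Descent along a chief series from [M = G], where the index is 1, to [M = 1], where it is [#|X|].
   In general [#|X : M|] is the index of the intersection of [X] and [M]. *)
suff: forall n (M : {group gT}),
    #|M| < n -> M <| G -> tau.-nat #|X : M| -> tau.-group X.
  move/(_ _ G (ltnSn _) (normal_refl G)); apply.
  by rewrite -indexgI (setIidPl sXG) indexgg.
elim=> // n IHn M ltMn nsMG tauXM.
have [M1 | ntM] := eqVneq (M :> {set gT}) 1; first by rewrite M1 indexg1 in tauXM.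
have [K maxK] : {K : {group gT} | chief_factor G K M}.
  have [|K maxK] := @ex_maxgroup _
    [pred K : {group gT} | (K \proper M) && (G \subset 'N(K))].
    by exists 1%G; rewrite /= proper1G ntM norms1.
  by exists K; rewrite /chief_factor /maxnormal maxK.
have /andP[/maxgroupp/andP[ltKM nKG] _] := maxK.
have nsKG : K <| G.
  by rewrite /normal nKG (subset_trans (proper_sub ltKM)) // normal_sub.
apply: (IHn K) => //.
  by rewrite -ltnS (leq_trans _ ltMn) // ltnS proper_card.
have nKX := subset_trans sXG nKG.
rewrite -card_quotient //.
have [minV sVG /is_abelemP[p p_pr abelV]] := chief_factor_solvable solG maxK.
have ntV : M / K != 1 by case/mingroupp/andP: minV.
have [_ pV _] := pgroup_pdiv (abelem_pgroup abelV) ntV.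
have [k pk] := sigma_cover sigmaP p_pr.
have [l nkl autkl] := autG p M K k p_pr maxK pV pk.
have tauXV : tau.-nat #|X / K : M / K|.
  by apply: pnat_dvd tauXM; rewrite index_quotient // subIset // nKX.
have [tp | tau'p] := boolP (p \in tau).
  rewrite /pgroup -(LagrangeI (X / K) (M / K)) pnatM tauXV andbT.
  apply: sub_in_pnat (pgroupS (subsetIr _ _) (abelem_pgroup abelV)) => r _ /eqnP->.
  exact: tp.
have [sA sB] := (subset_trans sAG nKG, subset_trans sBG nKG).
rewrite /= quotientY //.
apply: (@pgroup_join_over _ _ _ (G / K)%G (M / K)%G (A / K)%G (B / K)%G).
- exact: quotient_sol.
- exact: sVG.
- exact: quotientS.
- exact: quotientS.
- by rewrite quotient_norms ?normal_norm.
- exact: quotient_pgroup.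
- exact: quotient_pgroup.
- by rewrite -quotientY.
- by apply: sub_in_pnat (abelem_pgroup abelV) => r _ /eqnP->.
have cent m (C : {group gT}) : C \subset G -> (sigma m).-group C -> k <> m -> l <> m ->
    C / K \subset 'C(M / K).
  move=> sCG mC nkm nlm; apply/subsetP => x Cx.
  have Gx : x \in G / K by rewrite (subsetP (quotientS K sCG)).
  move/(induced_aut_pgroupP maxK): autkl => /(_ x Gx); apply.
  apply: sub_in_pnat (mem_p_elt (quotient_pgroup K mC) Cx) => r _ mr.
  rewrite !inE negb_or; apply/andP; split.
    exact: (sigma_dis sigmaP (nesym nkm) mr).
  exact: (sigma_dis sigmaP (nesym nlm) mr).
have [nki nkj] : k <> i /\ k <> j.
  by split=> km; case/negP: tau'p; rewrite !inE -km pk ?orbT.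
(* Only the blocks [k] and [l] can act nontrivially on [M / K], and [l] differs from [i] or from
   [j]. *)
have [li | nli] := pselect (l = i).
  by right; apply: (cent j) => //; rewrite li.
by left; apply: (cent i).
Qed.

End Sigma.

(** * A group showing that three blocks prevent saturation *)

(* [(x, y, z, (s, t))] stands for the matrix [[s, x, z], [0, 1, y], [0, 0, t]]. *)
Definition btriang (F : finFieldType) : Type :=
  (F * F * F * ({unit F} * {unit F}))%type.

Section BtriangGroup.

Variable F : finFieldType.
Local Notation T := (btriang F).

HB.instance Definition _ := Finite.on T.

Definition xcoef (g : T) : F := g.1.1.1.
Definition ycoef (g : T) : F := g.1.1.2.
Definition zcoef (g : T) : F := g.1.2.
Definition scoef (g : T) : {unit F} := g.2.1.
Definition tcoef (g : T) : {unit F} := g.2.2.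

Definition btriang_mul (g h : T) : T :=
  ((val (scoef g) * xcoef h + xcoef g)%R,
   (ycoef h + ycoef g * val (tcoef h))%R,
   (val (scoef g) * zcoef h + xcoef g * ycoef h + zcoef g * val (tcoef h))%R,
   (scoef g * scoef h, tcoef g * tcoef h)).

Definition btriang_one : T := (0%R, 0%R, 0%R, (1, 1)).

Definition btriang_inv (g : T) : T :=
  let s' := val ((scoef g)^-1) in let t' := val ((tcoef g)^-1) in
  ((- s' * xcoef g)%R, (- ycoef g * t')%R,
   (s' * (xcoef g * ycoef g - zcoef g) * t')%R, ((scoef g)^-1, (tcoef g)^-1)).

Lemma btriangP (g h : T) :
  xcoef g = xcoef h -> ycoef g = ycoef h -> zcoef g = zcoef h ->
  scoef g = scoef h -> tcoef g = tcoef h -> g = h.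
Proof.
case: g h => [[[x y] z] [s t]] [[[x' y'] z'] [s' t']].
by rewrite /xcoef /ycoef /zcoef /scoef /tcoef /= => -> -> -> -> ->.
Qed.

Let coefM (g h : T) :
  ((xcoef (btriang_mul g h) = val (scoef g) * xcoef h + xcoef g)%R *
   (ycoef (btriang_mul g h) = ycoef h + ycoef g * val (tcoef h))%R *
   (zcoef (btriang_mul g h) =
      val (scoef g) * zcoef h + xcoef g * ycoef h + zcoef g * val (tcoef h))%R *
   (scoef (btriang_mul g h) = scoef g * scoef h)%g *
   (tcoef (btriang_mul g h) = tcoef g * tcoef h)%g)%type.
Proof. by []. Qed.

Lemma btriang_mulA : associative btriang_mul.
Proof.
move=> g h k; apply: btriangP; rewrite !coefM ?mulgA //= ; ring.
Qed.

Lemma btriang_mul1 : left_id btriang_one btriang_mul.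
Proof.
move=> g; apply: btriangP; rewrite !coefM ?mul1g //= /xcoef /ycoef /zcoef /=; ring.
Qed.

Lemma btriang_mulV : left_inverse btriang_one btriang_inv btriang_mul.
Proof.
move=> g; have ut : (val ((tcoef g)^-1)%g * val (tcoef g) = 1)%R.
  by rewrite /= mulVr // (valP (tcoef g)).
apply: btriangP; rewrite !coefM ?mulVg //.
- by rewrite /xcoef /= mulNr subrr.
- by rewrite /ycoef /= -mulrA ut mulr1 subrr.
- by rewrite /zcoef /= -!mulrA ut /xcoef /ycoef /=; ring.
Qed.

HB.instance Definition _ := Finite_isGroup.Build T
  btriang_mulA btriang_mul1 btriang_mulV.

Lemma btriangM (g h : T) :
  ((xcoef (g * h)%g = val (scoef g) * xcoef h + xcoef g)%R *
   (ycoef (g * h)%g = ycoef h + ycoef g * val (tcoef h))%R *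
   (zcoef (g * h)%g =
      val (scoef g) * zcoef h + xcoef g * ycoef h + zcoef g * val (tcoef h))%R *
   (scoef (g * h)%g = scoef g * scoef h)%g *
   (tcoef (g * h)%g = tcoef g * tcoef h)%g)%type.
Proof. by []. Qed.

End BtriangGroup.

Section BtriangSubgroups.

Variable F : finFieldType.
Implicit Types g h : btriang F.

Lemma btriang1 :
  ((xcoef (1 : btriang F) = 0%R) * (ycoef (1 : btriang F) = 0%R) *
   (zcoef (1 : btriang F) = 0%R) * (scoef (1 : btriang F) = 1) *
   (tcoef (1 : btriang F) = 1))%type.
Proof. by []. Qed.

Lemma btriangV g :
  ((xcoef g^-1%g = - (val ((scoef g)^-1)%g * xcoef g))%R *
   (ycoef g^-1%g = - (ycoef g * val ((tcoef g)^-1)%g))%R *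
   (scoef g^-1 = (scoef g)^-1) * (tcoef g^-1 = (tcoef g)^-1))%type.
Proof. by rewrite -mulNr -[(- (ycoef g * _))%R]mulNr. Qed.

Lemma mulVu (u : {unit F}) : (val (u^-1)%g * val u = 1)%R.
Proof. by rewrite /= mulVr // (valP u). Qed.

Lemma scoefX g n : scoef (g ^+ n) = scoef g ^+ n.
Proof. by elim: n => // n IHn; rewrite !expgS btriangM IHn. Qed.

Lemma tcoefX g n : tcoef (g ^+ n) = tcoef g ^+ n.
Proof. by elim: n => // n IHn; rewrite !expgS btriangM IHn. Qed.

Lemma xcoefX g n : scoef g = 1 -> xcoef (g ^+ n) = (xcoef g *+ n)%R.
Proof.
move=> s1; elim: n => // n IHn.
by rewrite expgSr mulrS btriangM scoefX s1 expg1n mul1r IHn.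
Qed.

Lemma ycoefX g n : tcoef g = 1 -> ycoef (g ^+ n) = (ycoef g *+ n)%R.
Proof.
move=> t1; elim: n => // n IHn.
by rewrite expgS mulrSr btriangM tcoefX t1 expg1n mulr1 IHn.
Qed.

Variables (p : nat) (A B : {group {unit F}}).
Hypothesis charF : p \in [pchar F]%R.

Definition btriang_set := [set g : btriang F | (scoef g \in A) && (tcoef g \in B)].

Lemma btriang_group_set : group_set btriang_set.
Proof.
apply/group_setP; split=> [|g h]; rewrite !inE ?btriang1 ?group1 //.
by move=> /andP[sg tg] /andP[sh th]; rewrite !btriangM !groupM.
Qed.
Definition btriang_group := Group btriang_group_set.
Local Notation G := btriang_group.

(** [lker_set] and [rker_set] are the kernels of the maps to the upper left and lower right 2 by 2
    diagonal blocks. *)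
Definition lker_set := [set g in G | (scoef g == 1) && (xcoef g == 0%R)].
Definition rker_set := [set g in G | (tcoef g == 1) && (ycoef g == 0%R)].

Lemma lker_group_set : group_set lker_set.
Proof.
apply/group_setP; split=> [|g h]; rewrite !inE ?btriang1 ?group1 ?eqxx //.
move=> /and3P[/andP[sg tg] /eqP s1 /eqP x0] /and3P[/andP[sh th] /eqP s1' /eqP x0'].
by rewrite !btriangM !groupM //= s1 s1' x0 x0' mulg1 mulr0 addr0 !eqxx.
Qed.
Definition lker := Group lker_group_set.

Lemma rker_group_set : group_set rker_set.
Proof.
apply/group_setP; split=> [|g h]; rewrite !inE ?btriang1 ?group1 ?eqxx //.
move=> /and3P[/andP[sg tg] /eqP s1 /eqP x0] /and3P[/andP[sh th] /eqP s1' /eqP x0'].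
by rewrite !btriangM !groupM //= s1 s1' x0 x0' mulg1 mul0r addr0 !eqxx.
Qed.
Definition rker := Group rker_group_set.

Lemma lkerE g : (g \in lker) = [&& g \in G, scoef g == 1 & xcoef g == 0%R].
Proof. exact: in_set. Qed.

Lemma rkerE g : (g \in rker) = [&& g \in G, tcoef g == 1 & ycoef g == 0%R].
Proof. exact: in_set. Qed.

Lemma lker_normal : lker <| G.
Proof.
apply/andP; split; first by apply/subsetP=> g; rewrite inE => /andP[].
apply/subsetP=> h Gh; rewrite inE; apply/subsetP=> _ /imsetP[g + ->].
rewrite !lkerE => /and3P[Gg /eqP s1 /eqP x0].
rewrite groupJ //= conjgE !btriangM !btriangV s1 x0 mul1g mulVg eqxx /=.
by rewrite addr0 mul1r subrr.
Qed.

Lemma rker_normal : rker <| G.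
Proof.
apply/andP; split; first by apply/subsetP=> g; rewrite inE => /andP[].
apply/subsetP=> h Gh; rewrite inE; apply/subsetP=> _ /imsetP[g + ->].
rewrite !rkerE => /and3P[Gg /eqP t1 /eqP y0].
rewrite groupJ //= conjgE !btriangM !btriangV t1 y0 mul1g mulVg eqxx /=.
by rewrite mul0r addr0 mulNr -mulrA mulVu mulr1 subrr.
Qed.

Lemma coef_torsion (tau : nat_pred) (c : F) n :
  p \in tau -> tau^'.-nat n -> (c *+ n)%R = 0%R -> c = 0%R.
Proof.
move=> tp tau'n /eqP; rewrite -mulr_natr mulf_eq0 => /orP[/eqP // |].
rewrite -(dvdn_pcharf charF) => pn; have p_pr := pcharf_prime charF.
have := pnat_dvd pn tau'n; rewrite pnatE // !inE.
by rewrite tp.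
Qed.

Lemma unit_torsion (tau : nat_pred) (C : {group {unit F}}) u n :
  tau.-group C -> u \in C -> tau^'.-nat n -> u ^+ n = 1 -> u = 1.
Proof.
move=> tauC Cu tau'n un1; apply/eqP; rewrite -order_eq1; apply/eqP.
apply: (@pnat_1 tau); first exact: mem_p_elt tauC Cu.
by apply: pnat_dvd tau'n; rewrite order_dvdn un1.
Qed.

(** For a [tau^']-element [g] of order [n], first [scoef g = 1]; then [g ^+ n] has entry
    [xcoef g *+ n], which must vanish, and [n] is prime to the characteristic. *)
Lemma lker_quotient (tau : nat_pred) :
  p \in tau -> tau.-group A -> tau.-group (G / lker).
Proof.
move=> tp tauA; apply/pgroup_quotientP; first exact: normal_norm lker_normal.
move=> g Gg tau'g; rewrite inE Gg /=.
have s1 : scoef g = 1.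
  apply: (unit_torsion tauA _ tau'g); last by rewrite -scoefX expg_order.
  by move: Gg; rewrite inE => /andP[].
rewrite s1 eqxx /=; apply/eqP; apply: (coef_torsion tp tau'g).
by rewrite -xcoefX // expg_order.
Qed.

Lemma rker_quotient (tau : nat_pred) :
  p \in tau -> tau.-group B -> tau.-group (G / rker).
Proof.
move=> tp tauB; apply/pgroup_quotientP; first exact: normal_norm rker_normal.
move=> g Gg tau'g; rewrite inE Gg /=.
have t1 : tcoef g = 1.
  apply: (unit_torsion tauB _ tau'g); last by rewrite -tcoefX expg_order.
  by move: Gg; rewrite inE => /andP[].
rewrite t1 eqxx /=; apply/eqP; apply: (coef_torsion tp tau'g).
by rewrite -ycoefX // expg_order.
Qed.

End BtriangSubgroups.

(** * The unitriangular subgroup [U] and its corner [Z] *)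

Section BtriangCorner.

Variable F : finFieldType.
Implicit Types g h : btriang F.

Local Notation U := (btriang_group 1 1 : {group btriang F}).
Local Notation Z := (lker 1 1 :&: rker 1 1 : {set btriang F}).

Lemma unit_commg (u v : {unit F}) : [~ u, v] = 1.
Proof. by apply/eqP/commgP; apply: val_inj; rewrite /= mulrC. Qed.

Lemma unitriE g : (g \in U) = (scoef g == 1) && (tcoef g == 1).
Proof. by rewrite in_set !inE. Qed.

Lemma cornerE g :
  (g \in Z) = [&& g \in U, xcoef g == 0%R & ycoef g == 0%R].
Proof.
rewrite in_setI lkerE rkerE unitriE; case: (scoef g == 1); rewrite ?andbF //=.
by case: (tcoef g == 1); rewrite //= andbF.
Qed.

Lemma scoefR g h : scoef [~ g, h] = 1.
Proof. rewrite /commg /conjg !(btriangM, btriangV); exact: unit_commg. Qed.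

Lemma tcoefR g h : tcoef [~ g, h] = 1.
Proof. rewrite /commg /conjg !(btriangM, btriangV); exact: unit_commg. Qed.

Lemma corner_cent : Z \subset 'C(U).
Proof.
apply/subsetP=> g; rewrite cornerE unitriE.
move=> /and3P[/andP[/eqP s1 /eqP t1] /eqP x0 /eqP y0]; apply/centP=> h.
rewrite unitriE => /andP[/eqP s1' /eqP t1'].
apply: btriangP;
  rewrite !btriangM ?(s1, t1, x0, y0, s1', t1', mul1g, mulg1) //=; ring.
Qed.

(** [U] is a Heisenberg group; its commutator form comes from comparing entries in [g * h = h * g *
    [~ g, h]]. *)
Lemma corner_commg g h : g \in U -> h \in U ->
  [/\ [~ g, h] \in Z & zcoef [~ g, h] = (xcoef g * ycoef h - xcoef h * ycoef g)%R].
Proof.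
rewrite !unitriE => /andP[/eqP s1 /eqP t1] /andP[/eqP s1' /eqP t1'].
set c := [~ g, h]; have defc := commgC g h; rewrite -/c in defc.
have [sc tc] : scoef c = 1 /\ tcoef c = 1 by rewrite scoefR tcoefR.
clearbody c.
have xc : xcoef c = 0%R.
  have := congr1 (@xcoef F) defc.
  rewrite !btriangM s1 s1' !mul1g /= !mul1r [(xcoef h + _)%R]addrC => /esym/eqP.
  by rewrite -subr_eq0 addrK => /eqP.
have yc : ycoef c = 0%R.
  have := congr1 (@ycoef F) defc.
  rewrite !btriangM t1 t1' tc /= !mulr1 [(ycoef h + _)%R]addrC => /esym/eqP.
  by rewrite -subr_eq0 addrK => /eqP.
split; first by rewrite cornerE unitriE sc tc xc yc !eqxx.
have := congr1 (@zcoef F) defc.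
rewrite !btriangM s1 s1' t1 t1' tc yc /= !(mulr1, mul1r, mulr0, addr0) => eqz.
apply: (@addIr _ (zcoef g + xcoef h * ycoef g + zcoef h)%R).
by rewrite -eqz; ring.
Qed.

(** A subgroup [H] contained in its derived subgroup lies in [U] because diagonal entries commute,
    then in [Z], which is central in [U]; so [H] is abelian and thus trivial. *)
Lemma btriang_solvable (A B : {group {unit F}}) :
  solvable (btriang_group A B).
Proof.
apply/forallP=> H; apply/implyP; rewrite subsetI => /andP[_ sHH'].
have sHU : H \subset U.
  apply: subset_trans sHH' _; rewrite gen_subG; apply/subsetP=> _ /imset2P[g h _ _ ->].
  by rewrite unitriE scoefR tcoefR !eqxx.
have sHZ : H \subset Z.
  apply: subset_trans sHH' _; rewrite gen_subG.
  apply/subsetP=> _ /imset2P[g h Hg Hh ->].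
  by case: (corner_commg (subsetP sHU g Hg) (subsetP sHU h Hh)).
rewrite -subG1 (subset_trans sHH') // subG1; apply/eqP/commG1P.
exact: subset_trans (subset_trans sHZ corner_cent) (centS sHU).
Qed.

Lemma corner_sub_Phi (A B : {group {unit F}}) :
  lker A B :&: rker A B \subset 'Phi(btriang_group A B).
Proof.
have nsZG : lker A B :&: rker A B <| btriang_group A B.
  exact: normalI (lker_normal A B) (rker_normal A B).
have defZ : lker A B :&: rker A B = Z.
  apply/setP=> g; rewrite cornerE unitriE in_setI lkerE rkerE.
  rewrite [g \in btriang_group A B]in_set.
  have [->|_] := eqVneq (scoef g) 1; have [->|_] := eqVneq (tcoef g) 1;
    by rewrite ?group1 ?andbF.
rewrite defZ in nsZG *; apply/bigcapsP=> M /maximal_eqP[sMG maxM].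
have nZM := subset_trans sMG (normal_norm nsZG).
have [|defM|defG] := maxM (M <*> Z)%G (joing_subl _ _).
- by rewrite join_subG sMG normal_sub.
- by rewrite -defM joing_subr.
apply/subsetP=> z Zz.
(* If [M] and [Z] generate [G], then [M] contains unitriangular matrices with any prescribed [x] and
   [y] entries, and their commutators fill [Z]. *)
have lift (u : btriang F) : u \in U ->
    exists m, [/\ m \in M, m \in U, xcoef m = xcoef u & ycoef m = ycoef u].
  move=> Uu; have : u \in M <*> Z.
    rewrite -[M <*> Z]/(gval (M <*> Z)%G) defG.
    by move: Uu; rewrite unitriE in_set => /andP[/eqP-> /eqP->]; rewrite !group1.
  rewrite norm_joinEl // => /mulsgP[m c Mm Zc defu].
  have := Zc; rewrite cornerE => /and3P[Uc /eqP xc /eqP yc].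
  exists m; have Um : m \in U by rewrite -(groupMr _ Uc) -defu.
  move: Um Uc; rewrite !unitriE => /andP[/eqP s1 /eqP t1] /andP[/eqP s1' /eqP t1'].
  rewrite s1 t1 !eqxx defu !btriangM s1 t1' xc yc.
  by rewrite !(mulr0, mulr1, add0r).
(* With entries [x = zcoef z], [y = 0] and [x = 0], [y = 1], the commutator has corner entry
   [zcoef z]. *)
have [|m1 [Mm1 Um1 x1 y1]] := lift ((zcoef z, 0, 0, (1%g, 1%g))%R : btriang F).
- by rewrite unitriE !eqxx.
have [|m2 [Mm2 Um2 x2 y2]] := lift ((0, 1, 0, (1%g, 1%g))%R : btriang F).
- by rewrite unitriE !eqxx.
have [Zm zm] := corner_commg Um1 Um2.
suff -> : z = [~ m1, m2] by rewrite groupR.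
move: Zz Zm; rewrite !cornerE !unitriE.
move=> /and3P[/andP[/eqP s1 /eqP t1] /eqP x0 /eqP y0].
move=> /and3P[/andP[/eqP s1' /eqP t1'] /eqP x0' /eqP y0'].
apply: btriangP; rewrite ?(s1, t1, x0, y0, s1', t1', x0', y0') // zm x1 x2 y1 y2.
by rewrite /xcoef /ycoef /= mulr1 mul0r subr0.
Qed.

(** The diagonal matrices [a] and [b0] commute, so [b0] is conjugated by a corner element [w]. The
    result has corner entry [1 - beta], and it would commute with [a] only if
    [(alpha - 1) * (1 - beta) = 0]. *)
Lemma btriang_noncommuting (alpha beta : {unit F}) :
    alpha != 1 -> beta != 1 ->
  exists a b : btriang F,
    [/\ a \in btriang_group <[alpha]> <[beta]>,
        b \in btriang_group <[alpha]> <[beta]>,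
        a ^+ #[alpha] = 1, b ^+ #[beta] = 1
      & [~ a, b] \in Z /\ [~ a, b] != 1].
Proof.
move=> na nb.
pose a : btriang F := (0, 0, 0, (alpha, 1%g))%R.
pose b0 : btriang F := (0, 0, 0, (1%g, beta))%R.
pose w : btriang F := (0, 0, 1, (1%g, 1%g))%R.
have aX n : a ^+ n = (0, 0, 0, ((alpha ^+ n)%g, 1%g))%R :> btriang F.
  elim: n => // n IHn; rewrite expgS IHn; apply: btriangP; rewrite !btriangM /=.
  - by rewrite /xcoef /= mulr0 addr0.
  - by rewrite /ycoef /= mul0r addr0.
  - by rewrite /zcoef /xcoef /= !(mulr0, mul0r, addr0).
  - by rewrite expgS.
  - exact: mul1g.
have b0X n : b0 ^+ n = (0, 0, 0, (1%g, (beta ^+ n)%g))%R :> btriang F.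
  elim: n => // n IHn; rewrite expgS IHn; apply: btriangP; rewrite !btriangM /=.
  - by rewrite /xcoef /= mulr0 addr0.
  - by rewrite /ycoef /= mul0r addr0.
  - by rewrite /zcoef /xcoef /= !(mulr0, mul0r, addr0).
  - exact: mul1g.
  - by rewrite expgS.
have [xb yb] : xcoef (b0 ^ w) = 0%R /\ ycoef (b0 ^ w) = 0%R.
  rewrite conjgE !btriangM !btriangV /xcoef /ycoef /=.
  by rewrite !(mulr0, mul0r, addr0, oppr0).
have [sb tb] : scoef (b0 ^ w) = 1 /\ tcoef (b0 ^ w) = beta.
  by rewrite conjgE !btriangM !btriangV /scoef /tcoef /= !(invg1, mul1g, mulg1).
have zb : zcoef (b0 ^ w) = (1 - val beta)%R.
  move: (conjgC b0 w) xb yb sb tb; move: (b0 ^ w) => b defb xb yb sb tb.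
  have := congr1 (@zcoef F) defb; rewrite !btriangM tb yb.
  rewrite /zcoef /xcoef /ycoef /= !(mulr0, mul0r, addr0, mul1r, mulr1).
  by move=> ->; rewrite addrK.
have bX : (b0 ^ w) ^+ #[beta] = 1 by rewrite -conjXg b0X expg_order conj1g.
exists a, (b0 ^ w); move: (b0 ^ w) xb yb sb tb zb bX => b xb yb sb tb zb bX.
split=> //.
- by rewrite in_set cycle_id group1.
- by rewrite in_set sb tb cycle_id group1.
- by rewrite aX expg_order.
split.
  rewrite cornerE unitriE scoefR tcoefR !eqxx /commg /conjg.
  by rewrite !btriangM !btriangV xb yb /= !(mulr0, mul0r, addr0, oppr0) !eqxx.
apply/commgP=> /(congr1 (@zcoef F)); rewrite !btriangM zb tb sb xb yb.
rewrite /zcoef /xcoef /ycoef /= !(mulr0, mul0r, addr0, add0r, mul1r, mulr1) => /eqP.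
rewrite -subr_eq0 -{2}[(1 - _)%R]mul1r -mulrBl mulf_eq0 !subr_eq0.
rewrite [(1 == _)%R]eq_sym; case/orP=> /eqP u1; [case/eqP: na | case/eqP: nb];
  exact: val_inj.
Qed.

End BtriangCorner.

Lemma zcoefX (F : finFieldType) (g : btriang F) n :
  g \in lker 1 1 :&: rker 1 1 -> zcoef (g ^+ n) = (zcoef g *+ n)%R.
Proof.
rewrite cornerE unitriE => /and3P[/andP[/eqP s1 /eqP t1] /eqP x0 /eqP y0].
elim: n => // n IHn; rewrite expgS mulrS btriangM IHn s1 x0 tcoefX t1 expg1n.
by rewrite mul1r mul0r addr0 mulr1 addrC.
Qed.

Lemma finField_unit_orders (p q r : nat) :
    prime p -> prime q -> prime r -> p != q -> p != r ->
  exists (F : finFieldType) (alpha beta : {unit F}),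
    [/\ p \in [pchar F]%R, #[alpha] = q & #[beta] = r].
Proof.
move=> p_pr q_pr r_pr npq npr.
have qr_gt0 : 0 < q * r by rewrite muln_gt0 !prime_gt0.
have tot_gt0 : 0 < totient (q * r) by rewrite totient_gt0.
(* By Euler's theorem [q * r] divides [p ^ totient (q * r) - 1], the number of units. *)
have [F charF oF] := pPrimePowerField p_pr tot_gt0.
have co : coprime p (q * r).
  by rewrite coprimeMr !prime_coprime // !dvdn_prime2 // npq.
have dvd d : d %| q * r -> d %| #|[set: {unit F}]|.
  move=> dqr; rewrite card_finField_unit oF; apply: dvdn_trans dqr _.
  rewrite -subn1 -eqn_mod_dvd ?expn_gt0 ?prime_gt0 //.
  by apply/eqP; apply: Euler_exp_totient.
have [alpha _ oa] := Cauchy q_pr (dvd q (dvdn_mulr _ (dvdnn _))).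
have [beta _ ob] := Cauchy r_pr (dvd r (dvdn_mull _ (dvdnn _))).
by exists F, alpha, beta.
Qed.

(** * Failure of saturation for three blocks *)

Section Sigma.

Variables (I : Type) (sigma : I -> nat_pred).
Hypothesis sigmaP : prime_partition sigma.

Lemma saturated_small (i j k : I) :
  saturated (Hclass sigma) -> [\/ i = j, j = k | i = k].
Proof.
move=> sat; apply: contrapT => dist.
have nij : i <> j by move=> ?; apply: dist; constructor 1.
have njk : j <> k by move=> ?; apply: dist; constructor 2.
have nik : i <> k by move=> ?; apply: dist; constructor 3.
have [p p_pr ip] := sigma_nonempty sigmaP i.
have [q q_pr jq] := sigma_nonempty sigmaP j.
have [r r_pr kr] := sigma_nonempty sigmaP k.
have npq : p != q.
  by apply/eqP=> pq; apply: nij; apply: (sigma_inj sigmaP ip); rewrite pq.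
have npr : p != r.
  by apply/eqP=> pr; apply: nik; apply: (sigma_inj sigmaP ip); rewrite pr.
have [F [alpha [beta [charF oa ob]]]] := finField_unit_orders p_pr q_pr r_pr npq npr.
set G := btriang_group <[alpha]> <[beta]>.
have solG : solvable G := btriang_solvable _ _.
have resid (N : {group btriang F}) : N <| G -> Hclass sigma (G / N)%G ->
    residual (Hclass sigma) G \subset N.
  by move=> nsN HN; apply: (bigcap_inf N); rewrite nsN; apply/asboolP.
have /sat : residual (Hclass sigma) G \subset 'Phi(G).
  apply: subset_trans (corner_sub_Phi _ _); rewrite subsetI; apply/andP; split.
    apply: resid; first exact: lker_normal.
    apply: (@Hclass_predU _ _ sigmaP _ _ i j); first exact: quotient_sol.
    apply: (lker_quotient _ charF); rewrite ?inE ?ip // /pgroup -orderE oa.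
    by rewrite pnatE // !inE jq orbT.
  apply: resid; first exact: rker_normal.
  apply: (@Hclass_predU _ _ sigmaP _ _ i k); first exact: quotient_sol.
  apply: (rker_quotient _ charF); rewrite ?inE ?ip // /pgroup -orderE ob.
  by rewrite pnatE // !inE kr orbT.
case/(HclassP sigmaP) => _ /(_ j k njk) clG.
have [||] := @btriang_noncommuting F alpha beta.
- by rewrite -order_eq1 oa; case: (q) q_pr => [|[]].
- by rewrite -order_eq1 ob; case: (r) r_pr => [|[]].
move=> a [b [Ga Gb aq br [Zc ntc]]]; rewrite oa in aq; rewrite ob in br.
have sigma_elt l s (g : btriang F) : s \in sigma l -> prime s -> g ^+ s = 1 ->
    (sigma l).-group <[g]>.
  move=> ls s_pr gs; rewrite /pgroup -orderE.
  apply: (@pnat_dvd _ s); first by rewrite order_dvdn gs.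
  by rewrite pnatE.
have := clG <[a]>%G <[b]>%G; rewrite !cycle_subG.
move=> /(_ Ga Gb (sigma_elt j q a jq q_pr aq) (sigma_elt k r b kr r_pr br)) tauX.
have Xc : [~ a, b] \in <[a]> <*> <[b]>.
  by apply: groupR; rewrite mem_gen // inE cycle_id ?orbT.
(* The order of the commutator involves only primes from blocks [j] and [k], hence is prime to [p],
   while it annihilates the corner entry, an element of a field of characteristic [p]. *)
have zc : zcoef [~ a, b] = 0%R.
  apply: (@coef_torsion _ p charF [predU sigma j & sigma k]^' _ #[[~ a, b]]).
  - rewrite !inE negb_or (sigma_dis sigmaP nij ip).
    exact: (sigma_dis sigmaP nik ip).
  - by rewrite pnatNK; apply: mem_p_elt tauX Xc.
  - by rewrite -zcoefX // expg_order.
case/eqP: ntc; move: Zc; rewrite cornerE unitriE.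
move=> /and3P[/andP[/eqP s1 /eqP t1] /eqP x0 /eqP y0].
exact: btriangP.
Qed.

End Sigma.

Theorem theoremB (I : Type) (sigma : I -> nat_pred)
    (sigmaP : prime_partition sigma) :
  [/\ formation (Hclass sigma),
      hereditary (Hclass sigma),
      saturated (Hclass sigma) <-> [set: I]%classic #<= `I_2
    & `I_2 #<= [set: I]%classic ->
      forall (gT : finGroupType) (G : {group gT}),
        Hclass sigma G <->
        solvable G /\
        forall (p : nat) (H K : {group gT}),
          prime p -> chief_factor G K H -> p %| #|H / K| ->
          (exists i, p \notin sigma i /\ (sigma i).-group (induced_aut G H K))
          \/
          (exists i j, [/\ i <> j, p \in sigma i
             & [predU sigma i & sigma j].-group (induced_aut G H K)])].
Proof.
split.
- exact: Hclass_formation.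
- exact: Hclass_hereditary.
- split=> [sat|]; last exact: saturated_le2.
  by apply/card_le_I2P => i j k; exact: saturated_small sigmaP _ _ _ sat.
move=> /I2_card_leP[i1 [i2 n12]] gT G; split=> [HG | [solG autG]].
  have [solG _] := HG; split=> // p H K p_pr chiefHK pHK; right.
  have [k pk] := sigma_cover sigmaP p_pr.
  (* A second block exists, so the second alternative, with [p] in the first block, always
     applies. *)
  have [l nkl] : exists l, k <> l.
    have [->|] := pselect (k = i1); first by exists i2.
    by exists i1.
  have [j nkj autj] := Hclass_induced_aut sigmaP HG nkl chiefHK pk p_pr pHK.
  by exists k, j.
apply: induced_aut_Hclass => // p H K k p_pr chiefHK pHK pk.
have [[i [npi auti]] | [i [j [nij pi autij]]]] := autG p H K p_pr chiefHK pHK.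
  (* In the first alternative the block [i] differs from that of [p] and serves as the second
     block. *)
  exists i; first by move=> ki; rewrite -ki pk in npi.
  by apply: sub_in_pnat auti => r _; rewrite !inE orbC => ->.
by rewrite (sigma_inj sigmaP pk pi); exists j.
Qed.
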